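(* Let $n\ge1$, $\alpha,\beta>-1$ and $\sigma:=\alpha+\beta+1$. The dual Gauss--Legendre polynomials $dF^n_j(t;\alpha,\beta)$ $(0\le j\le n)$ are represented in the Jacobi polynomial basis as follows: $$dF^n_j(t;\alpha,\beta)=\sum_{i=0}^{n}\frac{1}{h^{(\alpha,\beta)}_i}\,a^{(\alpha,\beta)}_{ji}\,P^{(\alpha,\beta)}_i(t)\qquad(j=0,1,\ldots,n),$$ where, for $0\le i,j\le n$, $$a^{(\alpha,\beta)}_{ji}:=(-1)^i\frac{(\beta+1)_i}{i!}+\frac{i+\sigma}{2}\sum_{\ell=1}^{j}\omega_\ell\,P^{(\alpha+1,\beta+1)}_{i-1}(\tau_\ell).$$
   Context: $\Pi_k$ is the space of real univariate polynomials of degree at most $k$. $P_k$ is the $k$th Legendre polynomial (orthogonal on $[-1,1]$ with weight $1$, normalized by $P_k(1)=1$). Fix $n\ge1$; $-1<\tau_1<\cdots<\tau_n<1$ are the zeros of $P_n$, and $\omega_i:=\dfrac{2}{nP_{n-1}(\tau_i)P_n'(\tau_i)}$ $(1\le i\le n)$ are the Gauss--Legendre weights. Gauss--Legendre polynomials: put $G^n_0(t)\equiv\frac12$, $G^n_{n+1}(t)\equiv-\frac12$ and, for $1\le i\le n$, $$G^n_i(t):=\frac{nP_{n-1}(\tau_i)}{2}\int_{-1}^{t}\frac{P_n(x)}{x-\tau_i}\,\mathrm{d}x-\frac12 .$$ Then $F^n_i(t):=G^n_i(t)-G^n_{i+1}(t)$ for $0\le i\le n$. The polynomials $F^n_0,\ldots,F^n_n$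 form a basis of $\Pi_n$. Jacobi inner product: $\langle f,g\rangle_{\alpha,\beta}:=\int_{-1}^{1}(1-x)^\alpha(1+x)^\beta f(x)g(x)\,\mathrm{d}x$ $(\alpha,\beta>-1)$. The dual Gauss--Legendre polynomials $dF^n_j(\cdot;\alpha,\beta)\in\Pi_n$ $(0\le j\le n)$ are defined by the conditions $\langle F^n_i,dF^n_j(\cdot;\alpha,\beta)\rangle_{\alpha,\beta}=\delta_{ij}$ for $0\le i,j\le n$. $P^{(\alpha,\beta)}_k$ is the Jacobi polynomial of degree $k$, orthogonal with respect to $\langle\cdot,\cdot\rangle_{\alpha,\beta}$ and normalized by $P^{(\alpha,\beta)}_k(1)=(\alpha+1)_k/k!$, with the convention $P^{(\alpha,\beta)}_{-1}\equiv0$. Its squared norm is $$h^{(\alpha,\beta)}_k:=\langle P^{(\alpha,\beta)}_k,P^{(\alpha,\beta)}_k\rangle_{\alpha,\beta}=2^\sigma\frac{\Gamma(k+\alpha+1)\Gamma(k+\beta+1)}{k!\,(2k+\sigma)\,\Gamma(k+\sigma)}$$ (for $k=0$, $\sigma=0$ the product $\sigma\Gamma(\sigma)$ is read as $\Gamma(\sigma+1)=1$). $(z)_0:=1$, $(z)_i:=z(z+1)\cdots(z+i-1)$ is the Pochhammer symbol. An empty sum is $0$. *)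

(* Defs.v *)
From HB Require Import structures.
From mathcomp Require Import all_boot all_order all_algebra.
From mathcomp Require Import polyrcf.
From mathcomp Require Import all_classical all_reals all_analysis.

Set Implicit Arguments.
Unset Strict Implicit.
Unset Printing Implicit Defensive.

Import Order.TTheory GRing.Theory Num.Theory.
Import numFieldNormedType.Exports.

Local Open Scope classical_set_scope.
Local Open Scope ring_scope.

Section DualGaussLegendre.
Context {R : realType}.
Implicit Types (alpha beta x t z : R) (n k i j : nat).

Local Notation mu := (@lebesgue_measure R).

(* Oriented integral: [\int_a^b f], also when [b < a]. *)
Definition oint (a b : R) (f : R -> R) : R :=
  if a <= b then \int[mu]_(x in `[a, b]) f x
  else - \int[mu]_(x in `[b, a]) f x.

Definition pochhammer z k : R := \prod_(m < k) (z + m%:R).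

Definition wprod (w f g : R -> R) : R :=
  \int[mu]_(x in `[-1, 1]) (w x * f x * g x).

Definition jacobi_weight alpha beta x : R :=
  (1 - x) `^ alpha * (1 + x) `^ beta.

Definition jprod alpha beta (f g : R -> R) : R :=
  wprod (jacobi_weight alpha beta) f g.

(* [p] has degree exactly [k], is orthogonal on [-1, 1] to all polynomials of
   lower degree, and is normalized by [p(1) = c]. *)
Definition is_orthopoly (w : R -> R) k (c : R) (p : {poly R}) : Prop :=
  [/\ size p = k.+1,
      forall q : {poly R}, (size q <= k)%N -> wprod w (horner p) (horner q) = 0
    & p.[1] = c].

(* [xget 0] picks the (unique) polynomial satisfying the defining conditions. *)
Definition legendre k : {poly R} :=
  xget 0 [set p | is_orthopoly (fun=> 1) k 1 p].

Definition jacobi alpha beta k : {poly R} :=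
  xget 0 [set p | is_orthopoly (jacobi_weight alpha beta) k
                    (pochhammer (alpha + 1) k / k`!%:R) p].

(* [P^(alpha,beta)_(i-1)], with the convention [P^(alpha,beta)_(-1) = 0]. *)
Definition jacobi_pred alpha beta i : {poly R} :=
  if i is k.+1 then jacobi alpha beta k else 0.

Definition jacobi_sqnorm alpha beta k : R :=
  jprod alpha beta (horner (jacobi alpha beta k)) (horner (jacobi alpha beta k)).

(* Gauss-Legendre nodes, numbered from 1: [rootsR] is the increasing list of
   the real zeros. *)
Definition node n i : R := (rootsR (legendre n))`_i.-1.

Definition gl_weight n i : R :=
  2 / (n%:R * (legendre n.-1).[node n i] * (legendre n)^`().[node n i]).

(* At [x = node n i] the integrand takes the value [0 / 0 = 0]; a single point
   does not affect the integral. *)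
Definition GL_G n i t : R :=
  if i == 0%N then 1 / 2
  else if i == n.+1 then - (1 / 2)
  else n%:R * (legendre n.-1).[node n i] / 2
         * oint (-1) t (fun x => (legendre n).[x] / (x - node n i))
       - 1 / 2.

Definition GL_F n i t : R := GL_G n i t - GL_G n i.+1 t.

Definition is_dualGL n alpha beta j (p : {poly R}) : Prop :=
  (size p <= n.+1)%N /\
  forall i, (i <= n)%N -> jprod alpha beta (GL_F n i) (horner p) = (i == j)%:R.

Definition dualGL n alpha beta j : {poly R} :=
  xget 0 [set p | is_dualGL n alpha beta j p].

(* [a^(alpha,beta)_(j,i)] *)
Definition dualGL_coef n alpha beta j i : R :=
  let sigma := alpha + beta + 1 in
  (-1) ^+ i * (pochhammer (beta + 1) i / i`!%:R)
  + (i%:R + sigma) / 2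
    * \sum_(1 <= l < j.+1)
        gl_weight n l * (jacobi_pred (alpha + 1) (beta + 1) i).[node n l].

End DualGaussLegendre.

(* Main.v *)
Require Import Defs.
From mathcomp Require Import all_boot all_order all_algebra.
From mathcomp Require Import polyrcf ring lra.
From mathcomp Require Import all_classical all_reals all_analysis.
From mathcomp Require Import measurable_realfun.
Import Order.TTheory GRing.Theory Num.Theory.
Import numFieldNormedType.Exports.
Local Open Scope classical_set_scope.
Local Open Scope ring_scope.
Set Implicit Arguments.
Unset Strict Implicit.
Unset Printing Implicit Defensive.

(* Write L(p) for the integral of (1-x)^a (1+x)^b p over [-1, 1].  Since
   (1-x)^(a+1) (1+x)^(b+1) g vanishes at both ends, L annihilates
   (1-x^2) g' + (b-a-(a+b+2)x) g.  This identity alone shows that the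
   polynomials given by a Rodrigues recursion are orthogonal, that they take the
   values (a+1)_k/k! at 1 and (-1)^k (b+1)_k/k! at -1, and that
   (P_k^(a,b))' = (k+a+b+1)/2 P_(k-1)^(a+1,b+1).
   For q of degree at most n, Lagrange interpolation of q' at the zeros of P_n
   and summation by parts give q = sum_k b_k F_k with
   b_k = q(-1) + sum_(l <= k) omega_l q'(tau_l).  For q = P_i^(a,b) this
   coordinate is a_(k,i), so that <P_i, dF_j> = a_(j,i) by duality. *)

(** * Fundamental theorem of calculus for integrands singular at the endpoints *)

Section ImproperFTC.
Context {R : realType}.
Local Notation mu := (@lebesgue_measure R).
Implicit Types (a b : R) (f F : R -> R).

(** [f] may blow up at the ends, as Jacobi weights with negative exponents do. The difference of [F]
    and the indefinite integral of [f] is continuous on the closed interval with zero derivative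
    inside, so it is constant by the mean value theorem. *)
Lemma improper_FTC2 f F a b : a < b ->
  mu.-integrable `[a, b] (EFin \o f) ->
  {in `]a, b[, continuous f} ->
  (forall x : R, x \in `]a, b[ -> is_derive x 1 F (f x)) ->
  F @ a^'+ --> F a -> F @ b^'- --> F b ->
  \int[mu]_(x in `[a, b]) f x = F b - F a.
Proof.
move=> ab fi fc dF Fa Fb.
pose G x := \int[mu]_(t in `[a, x]) f t.
have cF : {within `[a, b], continuous F}.
  apply/continuous_within_itvP => //; split => // x xab.
  apply: differentiable_continuous; apply/derivable1_diffP.
  by have [] := dF x xab.
have cG : {within `[a, b], continuous G}.
  exact: parameterized_integral_continuous (ltW ab) fi.
have dH x : x \in `]a, b[ -> is_derive x 1 (F \- G) 0.
  move=> xab; have := xab; rewrite in_itv/= => /andP[ax xb].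
  have [dG G'] := continuous_FTC1_closed xb fi ax (fc _ xab).
  have dGx : is_derive x 1 G (f x).
    by apply: DeriveDef; [exact: dG|rewrite -derive1E; exact: G'].
  have dFx := dF _ xab.
  have -> : 0 = f x - f x :> R by rewrite subrr.
  exact: is_deriveB.
have cH : {within `[a, b], continuous (F \- G)}.
  by move=> x; apply: continuousB; [exact: cF|exact: cG].
have [c _] := @MVT _ _ (fun=> 0) _ _ ab dH cH.
have Ga0 : G a = 0 by rewrite /G set_itv1 Rintegral_set1.
rewrite mul0r /= Ga0 subr0 => /eqP; rewrite addrAC subr_eq0 => /eqP ->.
by [].
Qed.

(** On compact subintervals the integral of [f] is a difference of two values of [F], hence at most
    [M + M]. Monotone convergence carries this bound to the whole interval. *)
Lemma integrable_derivative_ge0 f F a b (M : R) : a < b ->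
  measurable_fun `[a, b] f ->
  {in `]a, b[, continuous f} ->
  (forall x : R, x \in `]a, b[ -> is_derive x 1 F (f x)) ->
  {in `[a, b], forall x, 0 <= f x} ->
  {in `]a, b[, forall x, `|F x| <= M} ->
  mu.-integrable `[a, b] (EFin \o f).
Proof.
move=> ab mf fc dF f0 FM.
(* The denominator starts at 3 so that [a + e i < b - e i] already for [i = 0]. *)
pose e i : R := (b - a) / i.+3%:R.
have e0 i : 0 < e i by rewrite divr_gt0 ?subr_gt0.
have e3 i : e i * 3 <= b - a.
  rewrite /e mulrAC ler_pdivrMr//; apply: ler_wpM2l; first by rewrite subr_ge0 ltW.
  by rewrite ler_nat.
pose S i : set R := `[a + e i, b - e i]%classic.
have Soo i : {subset `[a + e i, b - e i]%R <= `]a, b[%R}.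
  move=> x; rewrite !in_itv/= => /andP[h1 h2].
  by have := e0 i; move=> h; apply/andP; split; lra.
have ei i : a + e i < b - e i by have := e0 i; have := e3 i; lra.
have US : \bigcup_i S i = `]a, b[%classic.
  apply/seteqP; split => x /=.
    by move=> [i _]; rewrite /S/= => /Soo.
  rewrite in_itv/= => /andP[ax xb].
  pose m := Num.min (x - a) (b - x).
  have m0 : 0 < m by rewrite lt_min !subr_gt0 ax.
  (* This index makes [e] at most [m], the distance from [x] to the nearer endpoint. *)
  exists (Num.truncn ((b - a) / m)) => //; rewrite /S/=.
  have em : e (Num.truncn ((b - a) / m)) <= m.
    rewrite /e ler_pdivrMr// mulrC -ler_pdivrMr//.
    apply/ltW; apply: lt_trans (truncnS_gt _) _.
    by rewrite ltr_nat ltnS.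
  have : m <= x - a by rewrite ge_min lexx.
  have : m <= b - x by rewrite ge_min lexx orbT.
  rewrite in_itv/= => h1 h2; apply/andP; split; lra.
have ndS : nondecreasing_seq S.
  move=> i k ik; apply/subsetPset => x; rewrite /S/= !in_itv/= => /andP[h1 h2].
  have h : e k <= e i.
    rewrite /e; apply: ler_wpM2l; first by rewrite subr_ge0 ltW.
    by rewrite lef_pV2 ?posrE// ler_nat.
  by apply/andP; split; lra.
have cvgS : (\int[mu]_(x in S i) (f x)%:E @[i --> \oo] -->
    \int[mu]_(x in \bigcup_i S i) (f x)%:E)%E.
  apply: ge0_nondecreasing_set_cvg_integral => // i.
  - exact: measurable_itv.
  - apply/measurable_EFinP; apply: measurable_funS mf => //.
    by move=> x /Soo; exact: subset_itv_oo_cc.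
  - by move=> x /Soo xab; rewrite lee_fin f0//; exact: subset_itv_oo_cc xab.
have iS i : (\int[mu]_(x in S i) (f x)%:E <= (M + M)%:E)%E.
  rewrite /S (@continuous_FTC2 _ f F)//.
  - rewrite -EFinB lee_fin.
    have /FM h1 : b - e i \in `]a, b[.
      by apply: (Soo i); rewrite in_itv/= lexx andbT ltW.
    have /FM h2 : a + e i \in `]a, b[.
      by apply: (Soo i); rewrite in_itv/= lexx ltW.
    by move: h1 h2; rewrite !ler_norml => /andP[_ ?] /andP[? _]; lra.
  - apply: continuous_in_subspaceT => x /set_mem xS.
    by apply: fc; exact: (Soo i).
  - split.
    + move=> x xS; have [] // := dF x _.
      by apply: (Soo i); exact: subset_itv_oo_cc xS.
    + apply: cvg_at_right_filter; apply: differentiable_continuous.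
      apply/derivable1_diffP; have [] // := dF (a + e i) _.
      by apply: (Soo i); rewrite in_itv/= lexx ltW.
    + apply: cvg_at_left_filter; apply: differentiable_continuous.
      apply/derivable1_diffP; have [] // := dF (b - e i) _.
      by apply: (Soo i); rewrite in_itv/= lexx andbT ltW.
  - move=> x xS; rewrite derive1E; have /dF[] // : x \in `]a, b[.
    by apply: (Soo i); exact: subset_itv_oo_cc xS.
have fin : (\int[mu]_(x in `]a, b[) (f x)%:E <= (M + M)%:E)%E.
  rewrite -US; by apply: cvge_le cvgS; exact: nearW.
apply/integrableP; split; first exact/measurable_EFinP.
under eq_integral => x /set_mem xab do rewrite /= ger0_norm ?f0//.
rewrite -integral_itv_bndo_bndc; last first.
  apply/measurable_EFinP; apply: measurable_funS mf => //.
  exact: subset_itv_co_cc.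
rewrite -integral_itv_obnd_cbnd; last first.
  apply/measurable_EFinP; apply: measurable_funS mf => //.
  exact: subset_itv_oo_cc.
exact: le_lt_trans fin (ltry _).
Qed.

End ImproperFTC.

(** * Integrals against the Jacobi weight and the Pearson identity *)

Section JacobiWeight.
Context {R : realType}.
Local Notation mu := (@lebesgue_measure R).
Implicit Types (a b x : R) (p q g : {poly R}).

Lemma is_derive_powR1D a x : -1 < x ->
  is_derive x (1 : R) (fun y => (1 + y) `^ (a + 1)) ((a + 1) * (1 + x) `^ a).
Proof.
move=> x1.
have h : 0 < 1 + x by lra.
have h1 := is_derive1_powR (a + 1) h.
rewrite addrK in h1.
have h2 : is_derive x (1 : R) (fun y : R => 1 + y) 1.
  have := is_deriveD (is_derive_cst (1 : R) x (1 : R)) (is_derive_id x (1 : R)).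
  by rewrite add0r.
have := @is_derive1_comp R (@powR R ^~ (a + 1)) (fun y : R => 1 + y) x _ _ h1 h2.
by rewrite mulr1.
Qed.

Lemma is_derive_powR1B a x : x < 1 ->
  is_derive x (1 : R) (fun y => (1 - y) `^ (a + 1)) (- ((a + 1) * (1 - x) `^ a)).
Proof.
move=> x1.
have h : 0 < 1 - x by lra.
have h1 := is_derive1_powR (a + 1) h.
rewrite addrK in h1.
have h2 : is_derive x (1 : R) (fun y : R => 1 - y) (-1).
  have := is_deriveB (is_derive_cst (1 : R) x (1 : R)) (is_derive_id x (1 : R)).
  by rewrite sub0r.
have := @is_derive1_comp R (@powR R ^~ (a + 1)) (fun y : R => 1 - y) x _ _ h1 h2.
by rewrite mulrN1.
Qed.

Lemma continuous_powR1D a x : -1 < x ->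
  {for x, continuous (fun y : R => (1 + y) `^ a)}.
Proof.
move=> x1; apply: differentiable_continuous; apply/derivable1_diffP.
by have := is_derive_powR1D (a - 1) x1; rewrite subrK => -[].
Qed.

Lemma continuous_powR1B a x : x < 1 ->
  {for x, continuous (fun y : R => (1 - y) `^ a)}.
Proof.
move=> x1; apply: differentiable_continuous; apply/derivable1_diffP.
by have := is_derive_powR1B (a - 1) x1; rewrite subrK => -[].
Qed.

Lemma powRS a x : -1 < a -> 0 <= x -> x `^ (a + 1) = x * x `^ a.
Proof.
move=> a1 x0; have := @mulr_powRB1 _ x (a + 1).
by rewrite addrK => ->//; lra.
Qed.

Lemma measurable_powR1D a : measurable_fun setT (fun y : R => (1 + y) `^ a).
Proof.
apply: (@measurableT_comp _ _ _ _ _ _ (@powR R ^~ a)) => //.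
exact: measurable_funD.
Qed.

Lemma measurable_powR1B a : measurable_fun setT (fun y : R => (1 - y) `^ a).
Proof.
apply: (@measurableT_comp _ _ _ _ _ _ (@powR R ^~ a)) => //.
exact: measurable_funB.
Qed.

Lemma measurable_jacobi_weight a b : measurable_fun setT (@jacobi_weight R a b).
Proof.
by apply: measurable_funM; [exact: measurable_powR1B|exact: measurable_powR1D].
Qed.

Lemma continuous_jacobi_weight a b x : x \in `]-1, 1[ ->
  {for x, continuous (jacobi_weight a b)}.
Proof.
rewrite in_itv/= => /andP[x1 x2].
by apply: continuousM; [exact: continuous_powR1B|exact: continuous_powR1D].
Qed.

Lemma integrable_powR1D a : -1 < a ->
  mu.-integrable `[-1, 1] (EFin \o (fun y : R => (1 + y) `^ a)).
Proof.
move=> a1; have a0 : 0 < a + 1 by lra.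
have N11 : -1 < 1 :> R by lra.
apply: (@integrable_derivative_ge0 _ _ (fun y => (a + 1)^-1 * (1 + y) `^ (a + 1))
  _ _ ((a + 1)^-1 * 2 `^ (a + 1))) => //.
- by apply: measurable_funTS; exact: measurable_powR1D.
- by move=> x; rewrite in_itv/= => /andP[x1 _]; exact: continuous_powR1D.
- move=> x; rewrite in_itv/= => /andP[x1 _].
  have h := is_derive_powR1D a x1.
  apply: is_derive_eq; rewrite /GRing.scale/=.
  by field; lra.
- by move=> x _; exact: powR_ge0.
- move=> x; rewrite in_itv/= => /andP[x1 x2].
  rewrite ger0_norm; last by rewrite mulr_ge0 ?powR_ge0// invr_ge0 ltW.
  apply: ler_wpM2l; first by rewrite invr_ge0 ltW.
  by apply: ge0_ler_powR; rewrite ?nnegrE; lra.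
Qed.

Lemma integrable_powR1B a : -1 < a ->
  mu.-integrable `[-1, 1] (EFin \o (fun y : R => (1 - y) `^ a)).
Proof.
move=> a1; have a0 : 0 < a + 1 by lra.
have N11 : -1 < 1 :> R by lra.
apply: (@integrable_derivative_ge0 _ _ (fun y => - (a + 1)^-1 * (1 - y) `^ (a + 1))
  _ _ ((a + 1)^-1 * 2 `^ (a + 1))) => //.
- by apply: measurable_funTS; exact: measurable_powR1B.
- by move=> x; rewrite in_itv/= => /andP[_ x1]; exact: continuous_powR1B.
- move=> x; rewrite in_itv/= => /andP[_ x1].
  have h := is_derive_powR1B a x1.
  apply: is_derive_eq; rewrite /GRing.scale/=.
  by field; lra.
- by move=> x _; exact: powR_ge0.
- move=> x; rewrite in_itv/= => /andP[x1 x2].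
  rewrite mulNr normrN ger0_norm; last by rewrite mulr_ge0 ?powR_ge0// invr_ge0 ltW.
  apply: ler_wpM2l; first by rewrite invr_ge0 ltW.
  by apply: ge0_ler_powR; rewrite ?nnegrE; lra.
Qed.

Lemma powR_le2 a x : 1 <= x <= 2 -> x `^ a <= 2 `^ `|a|.
Proof.
move=> /andP[x1 x2]; apply: (@le_trans _ _ (x `^ `|a|)).
  by apply: ler_powR => //; exact: ler_norm.
by apply: ge0_ler_powR; rewrite ?nnegrE//; lra.
Qed.

(** On each half of the interval one of the bases [1 - x], [1 + x] lies in [1, 2], and its power is
    bounded whatever the sign of the exponent. The weight is thus dominated by a multiple of the sum
    of the two one-sided powers. *)
Lemma integrable_jacobi_weight a b : -1 < a -> -1 < b ->
  mu.-integrable `[-1, 1] (EFin \o jacobi_weight a b).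
Proof.
move=> a1 b1.
have iB := integrable_powR1B a1; have iD := integrable_powR1D b1.
pose C : R := 2 `^ `|a| + 2 `^ `|b|.
apply: (@le_integrable _ _ _ mu _ _ _
    (EFin \o (fun x => C * (1 - x) `^ a + C * (1 + x) `^ b))) => //.
- by apply/measurable_EFinP; apply: measurable_funTS; exact: measurable_jacobi_weight.
- move=> x /=; rewrite in_itv/= => /andP[x1 x2]; rewrite lee_fin.
  have pB := powR_ge0 (1 - x) a; have pD := powR_ge0 (1 + x) b.
  have pa := powR_ge0 2 `|a|; have pb := powR_ge0 2 `|b|.
  have C0 : 0 <= C by rewrite addr_ge0.
  rewrite !ger0_norm ?(addr_ge0, mulr_ge0)// /C.
  rewrite /jacobi_weight; have [x0|x0] := leP 0 x.
  + have : (1 + x) `^ b <= 2 `^ `|b| by apply: powR_le2; lra.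
    move=> /(ler_wpM2l pB); move: (mulr_ge0 pa pB) (mulr_ge0 pa pD) (mulr_ge0 pb pD).
    move=> ? ? ? ?; lra.
  + have : (1 - x) `^ a <= 2 `^ `|a| by apply: powR_le2; lra.
    move=> /(ler_wpM2r pD); move: (mulr_ge0 pa pB) (mulr_ge0 pb pB) (mulr_ge0 pb pD).
    by move=> ? ? ? ?; lra.
- rewrite (_ : _ \o _ =
    (fun x => (C%:E * ((1 - x) `^ a)%:E) + C%:E * ((1 + x) `^ b)%:E)%E)//.
  by apply: integrableD => //; apply: integrableZl.
Qed.

(** The functional L of the opening comment, with its parameters explicit. *)
Definition wint a b p : R := \int[mu]_(x in `[-1, 1]) (jacobi_weight a b x * p.[x]).

Lemma horner_bounded p : exists M, forall x, x \in `[-1, 1] -> `|p.[x]| <= M.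
Proof.
exists (\sum_(i < size p) `|p`_i|) => x; rewrite in_itv/= => x1.
rewrite horner_coef; apply: le_trans (ler_norm_sum _ _ _) _.
apply: ler_sum => i _; rewrite normrM normrX ler_piMr//.
by apply: exprn_ile1 => //; rewrite ler_norml.
Qed.

Lemma integrable_wint a b p : -1 < a -> -1 < b ->
  mu.-integrable `[-1, 1] (EFin \o (fun x => jacobi_weight a b x * p.[x])).
Proof.
move=> a1 b1; have [M pM] := horner_bounded p.
have M0 : 0 <= M by apply: le_trans (pM 0 _); rewrite // in_itv/=; lra.
have iw := integrable_jacobi_weight a1 b1.
apply: (@le_integrable _ _ _ mu _ _ _
    (EFin \o (fun x => M * jacobi_weight a b x))) => //.
- apply/measurable_EFinP; apply: measurable_funM.
    by apply: measurable_funTS; exact: measurable_jacobi_weight.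
  exact: measurable_poly.
- move=> x /= x1; rewrite lee_fin !normrM mulrC ler_wpM2r//.
  by rewrite (ger0_norm M0) pM.
- rewrite (_ : _ \o _ = (fun x => (M%:E * (jacobi_weight a b x)%:E)%E))//.
  exact: integrableZl.
Qed.

Lemma wint_is_linear a b : -1 < a -> -1 < b -> linear (wint a b : {poly R} -> R^o).
Proof.
move=> a1 b1 k p q; rewrite /wint.
have ip := integrable_wint p a1 b1; have iq := integrable_wint q a1 b1.
rewrite /GRing.scale/= -RintegralZl// -RintegralD//.
  by apply: eq_Rintegral => x _; rewrite hornerD hornerZ; ring.
rewrite (_ : _ \o _ = (fun x => (k%:E * (jacobi_weight a b x * p.[x])%:E)%E))//.
exact: integrableZl.
Qed.

Lemma wint_ge0 a b p : (forall x, x \in `[-1, 1] -> 0 <= p.[x]) -> 0 <= wint a b p.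
Proof.
move=> p0; apply: Rintegral_ge0 => x /= x1.
by rewrite !mulr_ge0 ?powR_ge0 ?p0.
Qed.

(** If the integral were zero, the integrand would vanish almost everywhere. The weight is positive
    on the open interval and [p] has finitely many zeros, so the open interval, of measure 2, would
    be negligible. *)
Lemma wint_gt0 a b p : -1 < a -> -1 < b -> p != 0 ->
  (forall x, x \in `[-1, 1] -> 0 <= p.[x]) -> 0 < wint a b p.
Proof.
move=> a1 b1 pn0 p0; rewrite lt_neqAle wint_ge0// andbT eq_sym.
apply/eqP => int0.
pose f x := jacobi_weight a b x * p.[x].
have fi : mu.-integrable `[-1, 1] (EFin \o f) by exact: integrable_wint.
have f0 x : x \in `[-1, 1] -> 0 <= f x.
  by move=> x1; rewrite !mulr_ge0 ?powR_ge0 ?p0.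
have aef : ae_eq mu `[-1, 1]%classic (EFin \o f) (cst 0%E).
  apply/ae_eq_integral_abs => //; first exact: (measurable_int mu).
  under eq_integral => x /set_mem x1 do rewrite /= ger0_norm ?f0//.
  rewrite -[LHS]fineK; first by rewrite -/(Rintegral mu _ f) -/(wint a b p) int0.
  exact: integrable_fin_num.
have ne0 : mu.-negligible [set x | p.[x] = 0].
  have finR : finite_set [set x | x \in rootsR p] by exact: finite_seq.
  exists [set x | x \in rootsR p]; split.
  - apply: countable_measurable; last exact: finite_set_countable.
    by move=> t; exact: measurable_set1.
  - by apply: countable_lebesgue_measure0; exact: finite_set_countable finR.
  - move=> x /= px; rewrite -roots_on_rootsR// inE; apply/andP; split => //.
    by rewrite rootE px.
have : mu.-negligible `]-1, 1[%classic.
  apply: negligibleS (negligibleU ne0 aef) => x /= x1.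
  have [px|px] := eqVneq p.[x] 0; [by left|right] => /=.
  have x1' : x \in `[-1, 1] by exact: subset_itv_oo_cc.
  move=> /(_ x1') [] /eqP; apply/negP.
  move: x1; rewrite in_itv/= => /andP[h1 h2].
  by rewrite !mulf_neq0// gt_eqF// powR_gt0; lra.
move=> ng; have : mu `]-1, 1[%classic = 0%E by apply/negligibleP.
have -> : mu `]-1, 1[%classic = (1 - -1)%:E.
  by rewrite lebesgue_measure_itv/= lte_fin ifT -?EFinB//; lra.
by move=> []; lra.
Qed.

Lemma jacobi_weightS a b x : -1 < a -> -1 < b -> -1 <= x <= 1 ->
  jacobi_weight (a + 1) (b + 1) x = (1 - x ^+ 2) * jacobi_weight a b x.
Proof.
move=> a1 b1 /andP[x1 x2].
by rewrite /jacobi_weight !powRS//; [ring|lra|lra].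
Qed.

Lemma wintS a b p : -1 < a -> -1 < b ->
  wint (a + 1) (b + 1) p = wint a b ((1 - 'X ^+ 2) * p).
Proof.
move=> a1 b1.
have E x : -1 <= x <= 1 -> jacobi_weight (a + 1) (b + 1) x * p.[x] =
    jacobi_weight a b x * ((1 - 'X ^+ 2) * p).[x].
  move=> x1; rewrite jacobi_weightS// !(hornerM, hornerXn, hornerD, hornerN, hornerC).
  by rewrite hornerX; ring.
by apply: eq_Rintegral => x /set_mem /=; rewrite in_itv/=; exact: E.
Qed.

(* [(1 - x)^a (1 + x)^b (pearson a b g)] is the derivative of
   [(1 - x)^(a+1) (1 + x)^(b+1) g]. *)
Definition pearson a b g : {poly R} :=
  (1 - 'X ^+ 2) * g^`() + ((b - a)%:P - (a + b + 2) *: 'X) * g.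

Lemma horner_pearson a b g x : (pearson a b g).[x] =
  (1 - x ^+ 2) * g^`().[x] + (b - a - (a + b + 2) * x) * g.[x].
Proof.
by rewrite !(hornerD, hornerM, hornerN, hornerZ, hornerC, hornerX, hornerXn).
Qed.

(** The integrand is the derivative of [F] below, which vanishes at both ends because the exponents
    [a + 1] and [b + 1] are positive. *)
Lemma wint_pearson a b g : -1 < a -> -1 < b ->
  wint a b (pearson a b g) = 0.
Proof.
move=> a1 b1; rewrite /wint.
have a0 : 0 < a + 1 by lra.
have b0 : 0 < b + 1 by lra.
pose F x := (1 - x) `^ (a + 1) * (1 + x) `^ (b + 1) * g.[x].
have F1 : F 1 = 0 by rewrite /F subrr powR0 ?mul0r// gt_eqF.
have FN1 : F (-1) = 0 by rewrite /F subrr powR0 ?mulr0 ?mul0r// gt_eqF.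
have contg (x : R) : {for x, continuous (horner g)} by exact: continuous_horner.
transitivity (F 1 - F (-1)); last by rewrite F1 FN1 subrr.
apply: improper_FTC2.
- by lra.
- exact: integrable_wint.
- move=> x x1; apply: continuousM; first exact: continuous_jacobi_weight.
  exact: continuous_horner.
- move=> x; rewrite in_itv/= => /andP[x1 x2].
  have dD := is_derive_powR1D b x1; have dB := is_derive_powR1B a x2.
  have dg : is_derive x (1 : R) (horner g) g^`().[x].
    by apply: DeriveDef; [exact: derivable_horner|rewrite -derive1E -derivE].
  have := is_deriveM (is_deriveM dB dD) dg.
  rewrite /GRing.scale/= => h; apply: is_derive_eq.
  rewrite horner_pearson.
  by rewrite !fctE /jacobi_weight /= !powRS//; [ring|lra|lra].
- rewrite FN1 -(mul0r g.[-1]) -(mulr0 ((1 - -1) `^ (a + 1))); apply: cvgM.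
    apply: cvgM.
      by apply: cvg_at_right_filter; apply: continuous_powR1B; lra.
    apply: (@increasing_cvg_at_right_comp _ (fun x => 1 + x)
      (@powR R ^~ (b + 1)) _ +oo%O) => //.
    + by move=> x y _ _ xy; rewrite ltrD2l.
    + by apply: cvg_at_right_filter; apply: cvgD; [exact: cvg_cst|exact: cvg_id].
    + by rewrite subrr; exact: powR_cvg0.
  by apply: cvg_at_right_filter; exact: contg.
- rewrite F1 -(mul0r g.[1]) -(mul0r ((1 + 1) `^ (b + 1))); apply: cvgM.
    apply: cvgM.
      apply: (@decreasing_cvg_at_left_comp _ (fun x => 1 - x)
        (@powR R ^~ (a + 1)) -oo%O) => //.
      + by move=> x y _ _ xy; rewrite ltrD2l ltrN2.
      + by apply: cvg_at_left_filter; apply: cvgB; [exact: cvg_cst|exact: cvg_id].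
      + by rewrite subrr; exact: powR_cvg0.
    by apply: cvg_at_left_filter; apply: continuous_powR1D; lra.
  by apply: cvg_at_left_filter; exact: contg.
Qed.

End JacobiWeight.

(** * Orthogonality and uniqueness up to the leading coefficient *)

Section Orthogonality.
Context {R : realType}.
Variables (a b : R).
Hypotheses (a1 : -1 < a) (b1 : -1 < b).
Implicit Types (p q r : {poly R}).

Lemma wintZD k p q : wint a b (k *: p + q) = k * wint a b p + wint a b q.
Proof. exact: wint_is_linear. Qed.

Lemma wint0 : wint a b 0 = 0.
Proof. by have := wintZD (-1) 0 0; rewrite scaler0 addr0; lra. Qed.

Lemma wintZ k p : wint a b (k *: p) = k * wint a b p.
Proof. by have := wintZD k p 0; rewrite !addr0 wint0 addr0. Qed.

Lemma wintD p q : wint a b (p + q) = wint a b p + wint a b q.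
Proof. by have := wintZD 1 p q; rewrite scale1r mul1r. Qed.

Lemma wintB p q : wint a b (p - q) = wint a b p - wint a b q.
Proof. by rewrite -scaleN1r wintD wintZ mulN1r. Qed.

Lemma wint_sum (I : Type) (s : seq I) (P : pred I) (F : I -> {poly R}) :
  wint a b (\sum_(i <- s | P i) F i) = \sum_(i <- s | P i) wint a b (F i).
Proof.
by elim/big_rec2: _ => [|i y p _ <-]; [exact: wint0|exact: wintD].
Qed.

Lemma wprodE p q :
  wprod (jacobi_weight a b) (horner p) (horner q) = wint a b (p * q).
Proof. by apply: eq_Rintegral => x _; rewrite hornerM mulrA. Qed.

Lemma wint_sqr_eq0 p : wint a b (p * p) = 0 -> p = 0.
Proof.
move=> pp0; apply/eqP/negPn/negP => pn0.
have : 0 < wint a b (p * p).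
  apply: wint_gt0 => //; first by rewrite mulf_neq0.
  by move=> x _; rewrite hornerM -expr2 sqr_ge0.
by rewrite pp0 ltxx.
Qed.

Definition orthogonal_below k p : Prop :=
  forall q, (size q <= k)%N -> wint a b (p * q) = 0.

Lemma size_sub_lead k p q : (size p <= k.+1)%N -> (size q <= k.+1)%N ->
  p`_k = q`_k -> (size (p - q)%R <= k)%N.
Proof.
move=> sp sq e; apply/leq_sizeP => j kj; rewrite coefB.
move: kj; rewrite leq_eqVlt => /orP[/eqP <-|kj]; first by rewrite e subrr.
by rewrite (leq_sizeP _ _ sp)// (leq_sizeP _ _ sq)// subrr.
Qed.

(** Equal coefficients of degree [k] leave [p - q] of degree below [k], so [p] and [q] are both
    orthogonal to it, and [p - q] is orthogonal to itself. *)
Lemma orthogonal_below_unique k p q : (size p <= k.+1)%N -> (size q <= k.+1)%N ->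
  orthogonal_below k p -> orthogonal_below k q -> p`_k = q`_k -> p = q.
Proof.
move=> sp sq op oq e; apply/eqP; rewrite -subr_eq0; apply/eqP.
apply: wint_sqr_eq0; rewrite {1}mulrBl wintB.
by rewrite op ?oq ?subrr//; exact: size_sub_lead.
Qed.

End Orthogonality.

(** * Jacobi polynomials: orthogonality, derivative, endpoint values *)

Section JacobiPolynomials.
Context {R : realType}.
Implicit Types (a b : R) (k : nat) (p q r s g : {poly R}).

(** Only the terms [- x^2 g'] and [- (a + b + 2) x g] reach degree [k + 1]. *)
Lemma coef_pearson a b g k : (size g <= k.+1)%N ->
  (pearson a b g)`_k.+1 = - (k%:R + a + b + 2) * g`_k.
Proof.
move=> sg.
have g0 j : (k < j)%N -> g`_j = 0 by move=> kj; rewrite nth_default// (leq_trans sg).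
rewrite /pearson !mulrBl mul1r -scalerAl !coefD !coefN coefCM coefZ coefXM coefXnM /=.
rewrite !coef_deriv (g0 k.+2)// (g0 k.+1)//.
case: k sg g0 => [|k] sg g0 /=; first by ring.
by rewrite subSS subn1 /= -mulr_natr -natr1; ring.
Qed.

Lemma size_deriv_le p k : (size p <= k.+1)%N -> (size p^`() <= k)%N.
Proof.
move=> /leq_sizeP sp; apply/leq_sizeP => j kj.
by rewrite coef_deriv sp ?mul0rn// ltnS.
Qed.

Lemma size_pearson a b g k : (size g <= k.+1)%N -> (size (pearson a b g) <= k.+2)%N.
Proof.
move=> sg; have sd : (size g^`() <= k)%N.
  exact: size_deriv_le.
rewrite /pearson; apply: leq_trans (size_polyD _ _) _; rewrite geq_max; apply/andP; split.
  apply: leq_trans (size_polyMleq _ _) _.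
  have s2 : (size (1 - 'X^2 : {poly R})%R <= 3)%N.
    apply: leq_trans (size_polyD _ _) _.
    by rewrite size_polyN size_polyXn size_poly1.
  by move: (leq_add s2 sd); case: (_ + _)%N.
apply: leq_trans (size_polyMleq _ _) _.
have s2 : (size ((b - a)%:P - (a + b + 2) *: 'X : {poly R})%R <= 2)%N.
  apply: leq_trans (size_polyD _ _) _; rewrite size_polyN geq_max; apply/andP; split.
    by apply: leq_trans (size_polyC_leq1 _) _.
  by apply: leq_trans (size_scale_leq _ _) _; rewrite size_polyX.
by move: (leq_add s2 sg); case: (_ + _)%N.
Qed.

Lemma pearsonM a b g q :
  pearson a b (g * q) = pearson a b g * q + (1 - 'X ^+ 2) * g * q^`().
Proof. by rewrite /pearson derivM; ring. Qed.

(* The Rodrigues formula, with one differentiation split off. *)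
Fixpoint jac a b k : {poly R} :=
  if k is m.+1 then - (2 * m.+1%:R)^-1 *: pearson a b (jac (a + 1) (b + 1) m)
  else 1.

Lemma size_jac_le a b k : (size (jac a b k) <= k.+1)%N.
Proof.
elim: k a b => [|k ih] a b /=; first by rewrite size_poly1.
by apply: leq_trans (size_scale_leq _ _) _; exact: size_pearson.
Qed.

Lemma coef_jacS a b k : (jac a b k.+1)`_k.+1 =
  (k.+1%:R + a + b + 1) / (2 * k.+1%:R) * (jac (a + 1) (b + 1) k)`_k.
Proof.
rewrite /= coefZ coef_pearson ?size_jac_le// mulrA; congr (_ * _).
have : k.+1%:R != 0 :> R by rewrite pnatr_eq0.
by rewrite -natr1 => k0; field.
Qed.

Lemma lead_jac_neq0 a b k : -1 < a -> -1 < b -> (jac a b k)`_k != 0.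
Proof.
elim: k a b => [|k ih] a b a1 b1; first by rewrite /= coef1 oner_eq0.
rewrite coef_jacS !mulf_neq0 ?invr_eq0 ?mulf_neq0 ?pnatr_eq0//; last by apply: ih; lra.
(* The factor equals [k + (a + 1) + (b + 1)], which is positive. *)
by rewrite gt_eqF// -natr1; have : 0 <= k%:R :> R by []; lra.
Qed.

Lemma size_jac a b k : -1 < a -> -1 < b -> size (jac a b k) = k.+1.
Proof.
move=> a1 b1; apply/eqP; rewrite eqn_leq size_jac_le/= ltnNge.
by apply: contra (lead_jac_neq0 k a1 b1) => sk; rewrite nth_default.
Qed.

Lemma jac_neq0 a b k : -1 < a -> -1 < b -> jac a b k != 0.
Proof. by move=> a1 b1; rewrite -size_poly_gt0 size_jac. Qed.

(** Integration by parts: [pearson a b] is, up to sign, the adjoint of differentiation between the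
    weights for [(a, b)] and [(a + 1, b + 1)]. *)
Lemma wint_pearsonM a b g q : -1 < a -> -1 < b ->
  wint a b (pearson a b g * q) = - wint (a + 1) (b + 1) (g * q^`()).
Proof.
move=> a1 b1; have := wint_pearson (g * q) a1 b1.
by rewrite pearsonM wintD// wintS// mulrA => /eqP; rewrite addr_eq0 => /eqP.
Qed.

(** Adjointness moves one step of the recursion onto [q] as a derivative, lowering its degree by
    one, while the induction hypothesis applies at the raised parameters. *)
Lemma jac_orthogonal a b k : -1 < a -> -1 < b -> orthogonal_below a b k (jac a b k).
Proof.
elim: k a b => [|k ih] a b a1 b1 q sq.
  by move: sq; rewrite leqn0 size_poly_eq0 => /eqP->; rewrite mulr0 wint0.
rewrite /= -scalerAl wintZ// wint_pearsonM// ih ?oppr0 ?mulr0//; try lra.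
exact: size_deriv_le.
Qed.

(** Both sides have the same coefficient of degree [k] and are orthogonal to lower degrees for the
    raised weight; on the left this is adjointness read backwards. *)
Lemma deriv_jacS a b k : -1 < a -> -1 < b ->
  (jac a b k.+1)^`() = ((k.+1%:R + a + b + 1) / 2) *: jac (a + 1) (b + 1) k.
Proof.
move=> a1 b1.
apply: (@orthogonal_below_unique _ (a + 1) (b + 1) _ _ k); try lra.
- exact/size_deriv_le/size_jac_le.
- by apply: leq_trans (size_scale_leq _ _) _; exact: size_jac_le.
- move=> q sq; rewrite mulrC.
  have := wint_pearsonM q (jac a b k.+1) a1 b1.
  rewrite [pearson _ _ _ * _]mulrC jac_orthogonal//; last first.
    (* For [k = 0] the test polynomial is zero; [size_pearson] needs a size bound that is a
       successor. *)
    case: k sq => [|k sq]; last exact: size_pearson.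
    rewrite leqn0 size_poly_eq0 => /eqP->.
    by rewrite /pearson deriv0 !mulr0 addr0 size_poly0.
  by move=> /eqP; rewrite eq_sym oppr_eq0 => /eqP.
- by move=> q sq; rewrite -scalerAl wintZ ?jac_orthogonal ?mulr0//; lra.
- rewrite coef_deriv coef_jacS coefZ -[LHS]mulr_natr.
  have : k.+1%:R != 0 :> R by rewrite pnatr_eq0.
  by move: k.+1%:R => K k0; field.
Qed.

Lemma pochhammerS (z : R) k : pochhammer z k.+1 = z * pochhammer (z + 1) k.
Proof.
rewrite /pochhammer big_ord_recl addr0; congr (_ * _).
by apply: eq_bigr => i _; rewrite -addrA nat1r.
Qed.

Lemma pochhammer_gt0 (z : R) k : 0 < z -> 0 < pochhammer z k.
Proof. by move=> z0; apply: prodr_gt0 => i _; rewrite ltr_wpDr. Qed.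

(** At 1 the factor [1 - x^2] removes the derivative and the other factor is [- 2 (a + 1)]. At -1 it
    is [2 (b + 1)], whence the alternating sign in [jac_N1]. *)
Lemma jac_1 a b k : (jac a b k).[1] = pochhammer (a + 1) k / k`!%:R.
Proof.
elim: k a b => [|k ih] a b /=.
  by rewrite hornerC /pochhammer big_ord0 divr1.
rewrite pochhammerS factS natrM hornerZ horner_pearson ih.
have k0 : k.+1%:R != 0 :> R by rewrite pnatr_eq0.
have f0 : k`!%:R != 0 :> R by rewrite pnatr_eq0 -lt0n fact_gt0.
by move: k.+1%:R k`!%:R k0 f0 => K L k0 f0; field; rewrite k0 f0.
Qed.

Lemma jac_N1 a b k :
  (jac a b k).[-1] = (-1) ^+ k * (pochhammer (b + 1) k / k`!%:R).
Proof.
elim: k a b => [|k ih] a b /=.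
  by rewrite hornerC /pochhammer big_ord0 divr1 mulr1.
rewrite pochhammerS factS natrM hornerZ horner_pearson ih (exprS _ k) sqrrN expr1n.
have k0 : k.+1%:R != 0 :> R by rewrite pnatr_eq0.
have f0 : k`!%:R != 0 :> R by rewrite pnatr_eq0 -lt0n fact_gt0.
by move: k.+1%:R k`!%:R k0 f0 => K L k0 f0; field; rewrite k0 f0.
Qed.

Lemma jac_orthopoly a b k : -1 < a -> -1 < b ->
  is_orthopoly (jacobi_weight a b) k (pochhammer (a + 1) k / k`!%:R) (jac a b k).
Proof.
move=> a1 b1; split; [exact: size_jac| |exact: jac_1].
by move=> q sq; rewrite wprodE jac_orthogonal.
Qed.

(** Any polynomial meeting the specification is a multiple of [jac a b k], and the prescribed value
    at 1, nonzero since [a + 1 > 0], fixes the multiple. *)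
Lemma jacobiE a b k : -1 < a -> -1 < b -> jacobi a b k = jac a b k.
Proof.
move=> a1 b1; apply: xget_unique; first exact: jac_orthopoly.
move=> p [sp op p1].
pose l := p`_k / (jac a b k)`_k.
have ln0 := lead_jac_neq0 k a1 b1.
have pE : p = l *: jac a b k.
  apply: (orthogonal_below_unique a1 b1 (k := k)).
  - by rewrite sp.
  - by apply: leq_trans (size_scale_leq _ _) _; exact: size_jac_le.
  - by move=> q sq; rewrite -wprodE op.
  - by move=> q sq; rewrite -scalerAl wintZ ?jac_orthogonal ?mulr0.
  - by rewrite coefZ divfK.
have c0 : pochhammer (a + 1) k / k`!%:R != 0.
  rewrite mulf_neq0 ?invr_eq0 ?pnatr_eq0 -?lt0n ?fact_gt0//.
  by rewrite gt_eqF// pochhammer_gt0//; lra.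
have l1 : l = 1.
  by apply: (mulIf c0); rewrite mul1r -[RHS]p1 pE hornerZ jac_1.
by rewrite pE l1 scale1r.
Qed.

Lemma legendreE k : legendre k = jac (0 : R) 0 k.
Proof.
rewrite -jacobiE; [|lra|lra]; rewrite /legendre /jacobi.
have -> : jacobi_weight 0 0 = (fun=> 1) :> (R -> R).
  by apply/funext => x; rewrite /jacobi_weight !powRr0 mulr1.
suff -> : pochhammer (0 + 1) k / k`!%:R = 1 :> R by [].
rewrite add0r (_ : pochhammer 1 k = k`!%:R) ?divff ?pnatr_eq0 -?lt0n ?fact_gt0//.
elim: k => [|k ih]; first by rewrite /pochhammer big_ord0.
by rewrite /pochhammer big_ord_recr/= -/(pochhammer _ _) ih nat1r -natrM mulnC factS.
Qed.

End JacobiPolynomials.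

(** * Simple real zeros, interlaced non-vanishing, completeness *)

Section Zeros.
Context {R : realType}.
Variables (a b : R).
Hypotheses (a1 : -1 < a) (b1 : -1 < b).
Implicit Types (p q r s : {poly R}) (x : R) (k : nat).

(* If [P = r s] then [0 = <P, s> = <r, s^2> > 0]. *)
Lemma jac_no_ge0_factor k r s : jac a b k = r * s -> (1 < size r)%N ->
  (forall x, x \in `[-1, 1] -> 0 <= r.[x]) -> False.
Proof.
move=> e sr r0.
have := jac_neq0 k a1 b1; rewrite e mulf_eq0 negb_or => /andP[rn0 sn0].
have ss : (size s <= k)%N.
  have := size_jac k a1 b1; rewrite e size_mul//.
  case: (size r) sr => [//|[//|m _]].
  by rewrite addSn/= addSn => -[<-]; exact: leq_addl.
have := jac_orthogonal a1 b1 ss; rewrite e -mulrA => rss.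
have : 0 < wint a b (r * (s * s)).
  apply: wint_gt0 => //; first by rewrite !mulf_neq0.
  by move=> x x1; rewrite !hornerM -expr2 mulr_ge0 ?r0 ?sqr_ge0.
by rewrite rss ltxx.
Qed.

Lemma jac_no_double_root k x s : jac a b k = ('X - x%:P) * (('X - x%:P) * s) -> False.
Proof.
rewrite mulrA => /jac_no_ge0_factor; apply.
  by rewrite size_mul ?polyXsubC_eq0// size_XsubC.
by move=> y _; rewrite hornerM -expr2 sqr_ge0.
Qed.

Lemma no_root_sign q : (forall x, ~~ root q x) ->
  (forall x, 0 <= q.[x]) \/ (forall x, 0 <= (- q).[x]).
Proof.
move=> nr.
have S x y : 0 < q.[x] * q.[y].
  rewrite ltNge; apply/negP => q0.
  wlog xy : x y q0 / x <= y.
    by move=> W; have [|/ltW] := leP x y; [exact: W|apply: W; rewrite mulrC].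
  by have [z _ rz] := polyrcf.poly_ivt xy q0; have := nr z; rewrite rz.
have [q0|q0] := leP 0 q.[0]; [left|right] => x.
  have := S 0 x; rewrite le_eqVlt in q0; case/orP: q0 => [/eqP <-|q0].
    by rewrite mul0r ltxx.
  by rewrite pmulr_rgt0// => /ltW.
by rewrite hornerN oppr_ge0; have := S 0 x; rewrite nmulr_rgt0// => /ltW.
Qed.

Lemma rootsR_root p x : p != 0 -> (x \in rootsR p) = root p x.
Proof. by move=> p0; rewrite -roots_on_rootsR. Qed.

Lemma uniq_rootsR p : uniq (rootsR p).
Proof. exact: uniq_roots. Qed.

(** Divide out the distinct real roots. The quotient has no real root, since one would give a double
    root, so it has constant sign; a nonconstant factor of constant sign is excluded. This gives
    [node] exactly [n] entries to index. *)
Lemma size_rootsR_jac k : size (rootsR (jac a b k)) = k.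
Proof.
set p := jac a b k; set s := rootsR p.
have pn0 : p != 0 by exact: jac_neq0.
have ps : all (root p) s by apply/allP => x; rewrite rootsR_root.
have [q pE] := uniq_roots_prod_XsubC ps (etrans (uniq_rootsE _) (uniq_rootsR p)).
have qn0 : q != 0 by move: pn0; rewrite pE mulf_eq0 negb_or => /andP[].
have nr x : ~~ root q x.
  apply/negP => rx.
  have xs : x \in s by rewrite rootsR_root// pE rootM rx.
  have /factor_theorem[q1 q1E] := rx.
  move: pE; rewrite (big_rem x)//= q1E => pE.
  apply: (@jac_no_double_root k x (q1 * \prod_(z <- rem x s) ('X - z%:P))).
  by rewrite -/p pE; ring.
have sq : size q = 1%N.
  apply/eqP; rewrite eqn_leq size_poly_gt0 qn0 andbT leqNgt; apply/negP => sq.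
  have [q0|q0] := no_root_sign nr.
    exact: (jac_no_ge0_factor pE sq).
  apply: (@jac_no_ge0_factor k (- q) (- \prod_(z <- s) ('X - z%:P))).
  - by rewrite mulrNN.
  - by rewrite size_polyN.
  - by [].
have := size_jac k a1 b1; rewrite -/p pE size_mul// ?sq; last first.
  by rewrite -size_poly_gt0 size_prod_XsubC.
by rewrite size_prod_XsubC /= => -[].
Qed.

Lemma jac_sqnorm_gt0 k : 0 < wint a b (jac a b k * jac a b k).
Proof.
apply: wint_gt0 => //; first by rewrite mulf_neq0 ?jac_neq0.
by move=> x _; rewrite hornerM -expr2 sqr_ge0.
Qed.

(** Subtracting the multiple of [jac a b k] with the same coefficient of degree [k] leaves a
    remainder orthogonal to it. *)
Lemma wint_jacM k r : (size r <= k.+1)%N ->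
  wint a b (jac a b k * r) =
  r`_k / (jac a b k)`_k * wint a b (jac a b k * jac a b k).
Proof.
move=> sr; set c := _ / _.
have sj : (size (c *: jac a b k) <= k.+1)%N.
  by apply: leq_trans (size_scale_leq _ _) _; exact: size_jac_le.
have -> : r = (r - c *: jac a b k) + c *: jac a b k by rewrite subrK.
rewrite mulrDr wintD// jac_orthogonal//; last first.
  by apply: size_sub_lead; rewrite ?coefZ ?divfK ?lead_jac_neq0.
by rewrite add0r -scalerAr wintZ// coefD coefB subrK.
Qed.

(** Write the two polynomials as [(X - x) u] and [(X - x) v]. Then the pairing of the first with
    [v], which is zero, equals that of the second with [u], which is nonzero as [u] has degree
    exactly [k]. This keeps the denominators of the weights nonzero. *)
Lemma jac_no_common_root k x : root (jac a b k.+1) x -> ~~ root (jac a b k) x.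
Proof.
move=> /factor_theorem[u uE]; apply/negP => /factor_theorem[v vE].
have un0 : u != 0.
  by have := jac_neq0 k.+1 a1 b1; rewrite uE mulf_eq0 negb_or => /andP[].
have vn0 : v != 0.
  by have := jac_neq0 k a1 b1; rewrite vE mulf_eq0 negb_or => /andP[].
have su : size u = k.+1.
  have := size_jac k.+1 a1 b1.
  by rewrite uE size_mul ?polyXsubC_eq0// size_XsubC addn2 => -[].
have sv : (size v <= k.+1)%N.
  have := size_jac k a1 b1; rewrite vE size_mul ?polyXsubC_eq0// size_XsubC addn2/=.
  by move=> [->].
have := jac_orthogonal a1 b1 sv; rewrite uE.
have -> : u * ('X - x%:P) * v = jac a b k * u by rewrite vE; ring.
rewrite wint_jacM ?su// => /eqP; apply/negP.
apply: mulf_neq0; last by rewrite gt_eqF ?jac_sqnorm_gt0.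
apply: mulf_neq0; last by rewrite invr_eq0 lead_jac_neq0.
by have := un0; rewrite -lead_coef_eq0 lead_coefE su.
Qed.

(** Pairing with the Jacobi polynomial of top degree kills the top coefficient of [r]; descend. *)
Lemma jac_complete k r : (size r <= k)%N ->
  (forall m, (m < k)%N -> wint a b (jac a b m * r) = 0) -> r = 0.
Proof.
elim: k r => [|k ih] r sr r0; first by apply/eqP; rewrite -size_poly_eq0 -leqn0.
apply: ih => [|m mk]; last by apply: r0; rewrite ltnW.
have := r0 k (ltnSn _); rewrite wint_jacM// => /eqP.
rewrite mulf_eq0 (gt_eqF (jac_sqnorm_gt0 k)) orbF mulf_eq0 invr_eq0.
rewrite (negPf (lead_jac_neq0 _ _ _))// orbF => /eqP rk.
apply/leq_sizeP => j; rewrite leq_eqVlt => /orP[/eqP <-//|kj].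
by rewrite nth_default// (leq_trans sr).
Qed.

End Zeros.

(** * Integrals of polynomials from -1 *)

Section PolynomialIntegral.
Context {R : realType}.
Local Notation mu := (@lebesgue_measure R).
Implicit Types (p q u : {poly R}) (t c : R).

Lemma integrable_horner p (x y : R) : mu.-integrable `[x, y] (EFin \o horner p).
Proof.
apply: continuous_compact_integrable; first exact: segment_compact.
by apply: continuous_subspaceT; exact: continuous_horner.
Qed.

Definition pint t p : R := \int[mu]_(x in `[-1, t]) p.[x].

Lemma pintZD t c p q : pint t (c *: p + q) = c * pint t p + pint t q.
Proof.
rewrite /pint -RintegralZl//; last exact: integrable_horner.
rewrite -RintegralD//; last exact: integrable_horner.
  by apply: eq_Rintegral => x _; rewrite hornerD hornerZ.
rewrite (_ : _ \o _ = (fun x => (c%:E * (p.[x])%:E)%E))//.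
by apply: integrableZl => //; exact: integrable_horner.
Qed.

Lemma pint_lincomb t n (c : 'I_n -> R) (u : 'I_n -> {poly R}) :
  pint t (\sum_(i < n) c i *: u i) = \sum_(i < n) c i * pint t (u i).
Proof.
apply: (big_ind2 (fun p x => pint t p = x)).
- by have := pintZD t (-1) 0 0; rewrite scaler0 addr0; lra.
- by move=> p x q y <- <-; rewrite -[p]scale1r pintZD scale1r mul1r.
- move=> i _; have := pintZD t (c i) (u i) 0; have := pintZD t (-1) 0 0.
  by rewrite scaler0 !addr0 => h ->; lra.
Qed.

Lemma pint_deriv t q : -1 <= t -> pint t q^`() = q.[t] - q.[-1].
Proof.
rewrite le_eqVlt => /orP[/eqP <-|t1].
  by rewrite /pint set_itv1 Rintegral_set1 subrr.
apply: improper_FTC2 => //.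
- exact: integrable_horner.
- by move=> x _; exact: continuous_horner.
- by apply: cvg_at_right_filter; exact: continuous_horner.
- by apply: cvg_at_left_filter; exact: continuous_horner.
Qed.

(** The integrands agree off the null set containing only [c], where the division by zero yields
    0. *)
Lemma oint_divX t u c : -1 <= t ->
  oint (-1) t (fun x => (u * ('X - c%:P)).[x] / (x - c)) = pint t u.
Proof.
move=> t1; rewrite /oint t1 /pint /Rintegral; congr fine.
have mD : measurable (`[-1, t]%classic `\ c : set (measurableTypeR R)).
  by apply: measurableD => //; exact: measurable_itv.
have mu_u : measurable_fun (`[-1, t]%classic `\ c) (fun x => (u.[x])%:E : \bar R).
  by apply/measurable_EFinP; exact: measurable_poly.
have E : {in `[-1, t]%classic `\ c, forall x,
    ((u * ('X - c%:P)).[x] / (x - c))%:E = (u.[x])%:E :> \bar R}.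
  move=> x /set_mem/= [_ /eqP xc]; rewrite hornerM hornerXsubC mulfK//.
  by rewrite subr_eq0.
rewrite -[LHS](@integral_setD1 _ _ c)//; last first.
  by apply: eq_measurable_fun mu_u => x xD; rewrite E.
rewrite -[RHS](@integral_setD1 _ _ c)//.
exact: eq_integral.
Qed.

End PolynomialIntegral.

(** * Lagrange interpolation at the nodes and Gauss-Legendre coordinates *)

Section Nodes.
Context {R : realType}.
Variable n : nat.
Hypothesis n0 : (0 < n)%N.
Implicit Types (p q : {poly R}) (t : R).

Local Notation P := (legendre n : {poly R}).
(** Nodes are numbered from 1; the shift lets [i] range over [i < n]. *)
Local Notation tau i := (node n i.+1 : R).

Let N1 : -1 < 0 :> R. Proof. by lra. Qed.

Lemma legendre_neq0 : P != 0.
Proof. by rewrite legendreE jac_neq0. Qed.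

Lemma size_rootsR_legendre : size (rootsR P) = n.
Proof. by rewrite legendreE size_rootsR_jac. Qed.

Lemma root_node i : (i < n)%N -> root P (tau i).
Proof.
by move=> i_n; rewrite -rootsR_root ?legendre_neq0// /node mem_nth// size_rootsR_legendre.
Qed.

Lemma node_eq i k : (i < n)%N -> (k < n)%N -> (tau i == tau k) = (i == k).
Proof.
by move=> i_n k_n; rewrite /node nth_uniq ?size_rootsR_legendre// uniq_rootsR.
Qed.

(* [P / (X - tau_i)], a multiple of the i-th Lagrange basis polynomial. *)
Definition node_quot i : {poly R} := P %/ ('X - (tau i)%:P).

Lemma node_quotE i : (i < n)%N -> P = node_quot i * ('X - (tau i)%:P).
Proof. by move=> i_n; rewrite divpK// dvdp_XsubCl root_node. Qed.

Lemma size_node_quot i : (i < n)%N -> size (node_quot i) = n.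
Proof.
move=> i_n; have := size_jac n N1 N1; rewrite -legendreE (node_quotE i_n).
rewrite size_mul ?polyXsubC_eq0//; first by rewrite size_XsubC addn2 => -[].
by apply/eqP => q0; have := legendre_neq0; rewrite (node_quotE i_n) q0 mul0r eqxx.
Qed.

Lemma node_quot_node i k : (i < n)%N -> (k < n)%N ->
  (node_quot i).[tau k] = if i == k then P^`().[tau k] else 0.
Proof.
move=> i_n k_n; have PE := node_quotE i_n.
case: eqVneq => [<-|ik].
  rewrite [in RHS]PE derivM derivXsubC mulr1 hornerD hornerM hornerXsubC subrr mulr0.
  by rewrite add0r.
have /eqP := root_node k_n; rewrite PE hornerM hornerXsubC => /eqP.
by rewrite mulf_eq0 subr_eq0 node_eq// (eq_sym k) (negPf ik) orbF => /eqP.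
Qed.

Lemma deriv_legendre_node_neq0 i : (i < n)%N -> P^`().[tau i] != 0.
Proof.
move=> i_n; have := node_quot_node i_n i_n; rewrite eqxx => <-.
apply/negP => /factor_theorem[s sE].
apply: (@jac_no_double_root R 0 0 N1 N1 n (tau i) s).
by rewrite -legendreE {1}(node_quotE i_n) sE; ring.
Qed.

Lemma legendre_pred_node_neq0 i : (i < n)%N -> (legendre n.-1).[tau i] != 0.
Proof.
move=> i_n; have := root_node i_n; rewrite !legendreE -{1}(prednK n0).
exact: jac_no_common_root.
Qed.

(** The difference of the two sides has degree below [n] and vanishes at the [n] distinct nodes. *)
Lemma lagrange_nodes p : (size p <= n)%N ->
  p = \sum_(i < n) (p.[tau i] / P^`().[tau i]) *: node_quot i.
Proof.
move=> sp; apply/eqP; rewrite -subr_eq0; set d := p - _; apply/eqP.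
apply: (@roots_geq_poly_eq0 _ d (rootsR P)); rewrite ?uniq_rootsR//; last first.
  rewrite size_rootsR_legendre; apply: leq_trans (size_polyD _ _) _.
  rewrite geq_max sp size_polyN; apply: leq_trans (size_sum _ _ _) _.
  apply/bigmax_leqP => i _; apply: leq_trans (size_scale_leq _ _) _.
  by rewrite size_node_quot.
apply/allP => x /(nthP 0)[k]; rewrite size_rootsR_legendre => k_n <-.
rewrite -/(node n k.+1) /root hornerD hornerN horner_sum (bigD1 (Ordinal k_n))//=.
rewrite big1 => [|i ik]; rewrite hornerZ node_quot_node//.
  by rewrite eqxx addr0 divfK ?subrr// deriv_legendre_node_neq0.
by rewrite ifN ?mulr0.
Qed.

Lemma GL_G_node i t : (i < n)%N -> -1 <= t ->
  GL_G n i.+1 t = n%:R * (legendre n.-1).[tau i] / 2 * pint t (node_quot i) - 1 / 2.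
Proof.
move=> i_n t1; rewrite /GL_G /= eqSS (ltn_eqF i_n).
rewrite -(oint_divX (node_quot i) (tau i) t1); congr (_ * oint _ _ _ - _).
by apply/funext => x; rewrite -node_quotE.
Qed.

(* Summing by parts against the [GL_F], these are the coordinates of [q]. *)
Definition GL_coord q k : R :=
  q.[-1] + \sum_(1 <= l < k.+1) gl_weight n l * q^`().[node n l].

Lemma GL_coordS q k :
  GL_coord q k.+1 = GL_coord q k + gl_weight n k.+1 * q^`().[node n k.+1].
Proof. by rewrite /GL_coord big_nat_recr//= addrA. Qed.

Lemma sum_by_parts (B G : nat -> R) m :
  \sum_(k < m.+1) B k * (G k - G k.+1) =
  B 0%N * G 0%N - B m * G m.+1 + \sum_(k < m) (B k.+1 - B k) * G k.+1.
Proof.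
elim: m => [|m ih]; first by rewrite big_ord_recl !big_ord0 !addr0 mulrBr.
by rewrite big_ord_recr ih [in RHS]big_ord_recr/=; ring.
Qed.

(** With b the coordinates, the boundary terms of the summation by parts give [(b_0 + b_n) / 2], the
    constants -1/2 in the [GL_G] telescope to [- (b_n - b_0) / 2], and the integrals add up to that
    of [q']. The total is [b_0 + q(t) - q(-1) = q(t)]. *)
Lemma GL_F_expansion q t : (size q <= n.+1)%N -> -1 <= t ->
  q.[t] = \sum_(k < n.+1) GL_coord q k * GL_F n k t.
Proof.
move=> sq t1; rewrite /GL_F (sum_by_parts (GL_coord q) (fun k => GL_G n k t)).
(* The prefactor of the integral in [GL_G] cancels against the weight, leaving the Lagrange
   coefficient of [q']. *)
have wE (k : 'I_n) : (GL_coord q k.+1 - GL_coord q k) * GL_G n k.+1 t =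
    q^`().[tau k] / P^`().[tau k] * pint t (node_quot k)
    - (GL_coord q k.+1 - GL_coord q k) / 2.
  rewrite GL_G_node// GL_coordS addrC addKr mulrBr mul1r; congr (_ - _).
  rewrite /gl_weight.
  have n0' : n%:R != 0 :> R by rewrite pnatr_eq0 -lt0n.
  have h1 := legendre_pred_node_neq0 (ltn_ord k).
  have h2 := deriv_legendre_node_neq0 (ltn_ord k).
  by field; rewrite n0' h1 h2.
rewrite (eq_bigr _ (fun k _ => wE k)) sumrB -pint_lincomb -lagrange_nodes ?size_deriv_le//.
rewrite pint_deriv// -mulr_suml.
have -> : \sum_(k < n) (GL_coord q k.+1 - GL_coord q k) = GL_coord q n - GL_coord q 0.
  rewrite -(big_mkord xpredT (fun k => GL_coord q k.+1 - GL_coord q k)).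
  by rewrite telescope_sumr.
have -> : GL_coord q 0 = q.[-1] by rewrite /GL_coord big_geq// addr0.
by rewrite /GL_G/= eqxx; field.
Qed.

End Nodes.

(** * Change of basis and the dual polynomials *)

Section DualBasis.
Context {R : realType}.
Variables (n : nat) (a b : R).
Hypotheses (n0 : (0 < n)%N) (a1 : -1 < a) (b1 : -1 < b).

Lemma dualGL_coefE j i : dualGL_coef n a b j i = GL_coord n (jac a b i) j.
Proof.
rewrite /dualGL_coef /GL_coord jac_N1; congr (_ + _).
rewrite mulr_sumr; apply: eq_bigr => l _; rewrite mulrCA; congr (_ * _).
(* For [i = 0] the convention that the polynomial of index -1 is zero matches the derivative of a
   constant. *)
case: i => [|i]; first by rewrite /= horner0 mulr0 derivC horner0.
rewrite /= jacobiE ?ltr_wpDr//.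
by rewrite deriv_jacS// hornerZ; congr (_ / _ * _); ring.
Qed.

Let J m := jac a b m.
Let h m := wint a b (J m * J m).
(** Column [m] of [A] holds the coordinates of [J m] in the [GL_F]; once [A^T] is known to be
    invertible, row [k] of its inverse [B] expands [GL_F n k] in the [J m]. *)
Let A : 'M[R]_n.+1 := \matrix_(k, m) GL_coord n (J m) k.
Let B : 'M[R]_n.+1 := invmx A^T.

Lemma jac_GL_F m t : (m < n.+1)%N -> -1 <= t ->
  (J m).[t] = \sum_(k < n.+1) GL_coord n (J m) k * GL_F n k t.
Proof.
move=> mn t1; apply: GL_F_expansion => //.
by apply: leq_trans (size_jac_le _ _ _) _.
Qed.

Lemma jac_orthogonal_neq m k : m != k -> wint a b (J m * J k) = 0.
Proof.
rewrite neq_ltn => /orP[mk|km]; last by rewrite jac_orthogonal// size_jac.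
by rewrite mulrC jac_orthogonal// size_jac.
Qed.

Lemma wint_jac_lincomb m (c : 'I_n.+1 -> R) (mn : (m < n.+1)%N) :
  wint a b (J m * \sum_(i < n.+1) c i *: J i) = c (Ordinal mn) * h m.
Proof.
rewrite mulr_sumr wint_sum// (bigD1 (Ordinal mn))//= big1 ?addr0.
  by rewrite -scalerAr wintZ.
move=> i im; rewrite -scalerAr wintZ// jac_orthogonal_neq ?mulr0//.
by rewrite eq_sym.
Qed.

(** A vector [v] in the left kernel gives a combination of the [J m] whose coordinates in the [GL_F]
    are all zero. It vanishes on [-1, 1], hence is the zero polynomial, and orthogonality of the
    [J m] forces [v = 0]. *)
Lemma unit_GL_coord : A^T \in unitmx.
Proof.
rewrite -row_free_unit; apply/inj_row_free => v vA.
pose p : {poly R} := \sum_(m < n.+1) v 0 m *: J m.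
have pt t : -1 <= t -> p.[t] = 0.
  move=> t1; rewrite /p horner_sum.
  under eq_bigr => m _ do rewrite hornerZ jac_GL_F// mulr_sumr.
  rewrite exchange_big /= big1// => k _.
  have /matrixP/(_ 0 k) := vA; rewrite !mxE => vk.
  transitivity ((\sum_(m < n.+1) v 0 m * A^T m k) * GL_F n k t).
    by rewrite mulr_suml; apply: eq_bigr => m _; rewrite !mxE mulrA.
  by rewrite vk mul0r.
have p0 : p = 0.
  apply: (wint_sqr_eq0 a1 b1); rewrite -(wint0 a1 b1).
  apply: eq_Rintegral => x /set_mem /=; rewrite in_itv/= => /andP[x1 _].
  by rewrite hornerM pt// horner0 mul0r.
apply/rowP => -[m mn]; rewrite mxE.
have := wint_jac_lincomb (v 0) mn; rewrite -/p p0 mulr0 wint0// => /esym/eqP.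
by rewrite mulf_eq0 (gt_eqF (jac_sqnorm_gt0 a1 b1 m)) orbF => /eqP.
Qed.

(* Inverting the coordinate matrix of the Jacobi polynomials shows that [GL_F]
   is polynomial on [[-1, 1]], without computing an antiderivative. *)
Definition GL_F_poly k : {poly R} := \sum_(m < n.+1) B k m *: J m.

Lemma GL_F_polyE (k : 'I_n.+1) t : -1 <= t -> GL_F n k t = (GL_F_poly k).[t].
Proof.
move=> t1; rewrite /GL_F_poly horner_sum.
under eq_bigr => m _ do rewrite hornerZ jac_GL_F// mulr_sumr.
rewrite exchange_big /=.
have S (l : 'I_n.+1) : \sum_(m < n.+1) B k m * (GL_coord n (J m) l * GL_F n l t) =
    (k == l)%:R * GL_F n l t.
  have /matrixP/(_ k l) := mulVmx unit_GL_coord; rewrite !mxE => <-.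
  by rewrite mulr_suml; apply: eq_bigr => m _; rewrite !mxE mulrA.
rewrite (bigD1 k)//= S eqxx mul1r big1 ?addr0// => l lk.
by rewrite S eq_sym (negPf lk) mul0r.
Qed.

Lemma jac_GL_F_poly (m : 'I_n.+1) : J m = \sum_(k < n.+1) A k m *: GL_F_poly k.
Proof.
rewrite /GL_F_poly; under eq_bigr => k _ do rewrite scaler_sumr.
rewrite exchange_big /=.
under eq_bigr => l _ do under eq_bigr => k _ do rewrite scalerA.
under eq_bigr => l _ do rewrite -scaler_suml.
have S l : \sum_(k < n.+1) A k m * B k l = (m == l)%:R.
  have /matrixP/(_ m l) := mulmxV unit_GL_coord; rewrite !mxE => <-.
  by apply: eq_bigr => k _; rewrite [A^T _ _]mxE.
under eq_bigr => l _ do rewrite S.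
rewrite (bigD1 m)//= eqxx scale1r big1 ?addr0// => l lm.
by rewrite eq_sym (negPf lm) scale0r.
Qed.

Lemma jprod_GL_F (k : 'I_n.+1) p :
  jprod a b (GL_F n k) (horner p) = wint a b (GL_F_poly k * p).
Proof.
rewrite -wprodE; apply: eq_Rintegral => x /set_mem /=; rewrite in_itv/= => /andP[x1 _].
by rewrite GL_F_polyE.
Qed.

(** Duality restated as prescribed pairings with the Jacobi basis: [A] transports the conditions one
    way, [B] the other. *)
Lemma dualGLP j p : (j < n.+1)%N -> is_dualGL n a b j p <->
  (size p <= n.+1)%N /\
  forall m, (m < n.+1)%N -> wint a b (J m * p) = GL_coord n (J m) j.
Proof.
move=> jn; split=> -[sp H]; split => //.
  move=> m mn.
  rewrite [X in wint a b (X * _)](jac_GL_F_poly (Ordinal mn)) mulr_suml.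
  rewrite wint_sum// (bigD1 (Ordinal jn))//= big1 ?addr0.
    by rewrite -scalerAl wintZ// -jprod_GL_F H//= eqxx mulr1 mxE.
  move=> k kj; have {}kj : (k == j :> nat) = false by apply: negbTE.
  by rewrite -scalerAl wintZ// -jprod_GL_F H ?kj ?mulr0// -ltnS.
move=> k kn; pose k' : 'I_n.+1 := Ordinal (kn : (k < n.+1)%N).
rewrite -[k in GL_F n k]/(nat_of_ord k') jprod_GL_F.
rewrite /GL_F_poly mulr_suml wint_sum//.
under eq_bigr => m _ do rewrite -scalerAl wintZ// H//.
have /matrixP/(_ k' (Ordinal jn)) := mulVmx unit_GL_coord.
by rewrite !mxE => <-; apply: eq_bigr => m _; rewrite !mxE.
Qed.

(** The sum has the prescribed pairings by orthogonality. Two polynomials with these pairings differ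
    by one orthogonal to every [J m] with [m <= n], which is zero by completeness, so the choice
    made by [xget] is determined. *)
Lemma dualGL_jac j : (j < n.+1)%N -> dualGL n a b j =
  \sum_(i < n.+1) (1 / h i * GL_coord n (J i) j) *: J i.
Proof.
move=> jn; set d := \sum_(i < _) _.
have dP : is_dualGL n a b j d.
  apply/dualGLP => //; split=> [|m mn].
    apply: leq_trans (size_sum _ _ _) _; apply/bigmax_leqP => i _.
    apply: leq_trans (size_scale_leq _ _) _.
    by apply: leq_trans (size_jac_le _ _ _) _.
  rewrite (wint_jac_lincomb _ mn)/= mul1r mulrAC mulVf ?mul1r//.
  by rewrite gt_eqF// jac_sqnorm_gt0.
apply: xget_unique => // p /dualGLP-/(_ jn) [sp Hp].
have [sd Hd] := (dualGLP _ jn).1 dP.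
apply/eqP; rewrite -subr_eq0; apply/eqP.
apply: (jac_complete a1 b1 (k := n.+1)).
  by apply: leq_trans (size_polyD _ _) _; rewrite size_polyN geq_max sp.
by move=> m mn; rewrite mulrBr wintB// -/(J m) Hp// Hd// subrr.
Qed.

End DualBasis.

Unset Implicit Arguments.

Theorem theorem3p6 (R : realType) (n : nat) (alpha beta : R)
    (hn : (1 <= n)%N) (halpha : -1 < alpha) (hbeta : -1 < beta)
    (j : nat) (hj : (j <= n)%N) :
  dualGL n alpha beta j =
    \sum_(0 <= i < n.+1)
      (1 / jacobi_sqnorm alpha beta i * dualGL_coef n alpha beta j i)
        *: jacobi alpha beta i.
Proof.
rewrite big_mkord dualGL_jac//; apply: eq_bigr => i _.
by rewrite /jacobi_sqnorm /jprod wprodE dualGL_coefE// jacobiE.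
Qed.
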